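(* Let $f:\mathbb{R}^2\to\mathbb{C}$ be 1-periodic in each variable, with absolutely convergent Fourier series $f(\mathbf{x})=\sum_{\mathbf{k}\in\mathbb{Z}^2}c_{\mathbf{k}}e^{2\pi i\,\mathbf{k}\cdot\mathbf{x}}$ (i.e. $\sum_{\mathbf{k}\in\mathbb{Z}^2}|c_{\mathbf{k}}|<\infty$), and let $P\ge 2$ be an integer. Then the bias $B_P[f]=I_P[f]-c_{\mathbf{0}}$ of the $P\times P$ tensor-product trapezoidal rule satisfies $$B_P[f]=\sum_{\mathbf{k}=(k_1,k_2)\in\mathbb{Z}^2\setminus\{\mathbf{0}\}}c_{\mathbf{k}}\,\tilde{\chi}_P\!\left(\frac{k_1}{P}\right)\tilde{\chi}_P\!\left(\frac{k_2}{P}\right)=\sum_{\mathbf{l}=(l_1,l_2)\in\mathbb{Z}^2\setminus\{\mathbf{0}\}}c_{(l_1P,\,l_2P)},$$ where $\tilde{\chi}_P(y)=\frac1P\sum_{j=0}^{P-1}e^{2\pi i y j}$.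
   Context: The Fourier coefficients are $c_{\mathbf{k}}=\int_{[0,1]^2}f(\mathbf{x})e^{-2\pi i\,\mathbf{k}\cdot\mathbf{x}}\,d\mathbf{x}$, and $f(\mathbf{x})$ equals the sum of its Fourier series for every $\mathbf{x}\in\mathbb{R}^2$; in particular $c_{\mathbf{0}}=\int_{[0,1]^2}f(\mathbf{x})\,d\mathbf{x}$ is the exact integral. The $P\times P$ tensor-product trapezoidal rule is $I_P[f]=\frac1{P^2}\sum_{j_1=0}^{P-1}\sum_{j_2=0}^{P-1}f\!\left(\frac{j_1}{P},\frac{j_2}{P}\right)$. The complex resonance function is $\tilde{\chi}_P(y)=\frac1P\sum_{j=0}^{P-1}e^{2\pi i y j}$ for $y\in\mathbb{R}$. *)

(* Defs.v *)
From HB Require Import structures.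
From mathcomp Require Import all_boot all_order all_algebra.
From mathcomp Require Import finmap complex.
From mathcomp Require Import all_classical all_reals all_analysis.
From mathcomp.analysis.showcase Require summability.

Set Implicit Arguments.
Unset Strict Implicit.
Unset Printing Implicit Defensive.

Import Order.TTheory GRing.Theory Num.Theory.
Import numFieldNormedType.Exports.
Import ComplexField.Normc.

Local Open Scope classical_set_scope.
Local Open Scope ring_scope.
Local Open Scope complex_scope.

(* e^{i t} *)
Definition expi (R : realType) (t : R) : R[i] := cos t +i* sin t.

(* e^{2 pi i t} *)
Definition e2pi (R : realType) (t : R) : R[i] := expi (2 * pi * t).

Definition dotp (R : realType) (k : int * int) (x : R * R) : R :=
  k.1%:~R * x.1 + k.2%:~R * x.2.

(* The Lebesgue integral of a complex-valued function, by real and imaginary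
   parts. *)
Definition Cintegral d (T : measurableType d) (R : realType)
    (mu : {measure set T -> \bar R}) (D : set T) (g : T -> R[i]) : R[i] :=
  (\int[mu]_(x in D) complex.Re (g x)) +i* (\int[mu]_(x in D) complex.Im (g x)).

Definition lebesgue_measure2 (R : realType) :=
  (@lebesgue_measure R \x @lebesgue_measure R)%E.

Definition unit_square (R : realType) : set (R * R) := `[0, 1] `*` `[0, 1].

Definition fourier_coef (R : realType) (f : R * R -> R[i]) (k : int * int) :
    R[i] :=
  Cintegral (@lebesgue_measure2 R) (@unit_square R)
    (fun x => f x * e2pi (- dotp k x)).

(* The finite sums of u over subsets of D converge to s along the net of finite
   subsets of D: for complex-valued u this is absolute convergence of
   sum_{i in D} u i, with value s.  The regular algebra R[i]^o carries the
   topology given by the modulus. *)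
Definition has_sum (R : realType) (I : choiceType) (D : set I) (u : I -> R[i])
    (s : R[i]) : Prop :=
  (fun A : {fset I} => \sum_(i <- A | i \in D) u i : R[i]^o)
    @ summability.totally --> (s : R[i]^o).

Definition abs_summable (R : realType) (I : choiceType) (D : set I)
    (u : I -> R[i]) : Prop :=
  esum.summable D (fun i => (normc (u i))%:E).

Definition trapezoid (R : realType) (P : nat) (f : R * R -> R[i]) : R[i] :=
  (P%:R ^+ 2)^-1 *
  \sum_(j1 < P) \sum_(j2 < P) f (j1%:R / P%:R, j2%:R / P%:R).

Definition bias (R : realType) (P : nat) (f : R * R -> R[i]) : R[i] :=
  trapezoid P f - fourier_coef f (0, 0).

Definition resonance (R : realType) (P : nat) (y : R) : R[i] :=
  P%:R^-1 * \sum_(j < P) e2pi (y * j%:R).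

(* Main.v *)
Require Import Defs.
From HB Require Import structures.
From mathcomp Require Import all_boot all_order all_algebra.
From mathcomp Require Import finmap complex.
From mathcomp Require Import all_classical all_reals all_analysis.
From mathcomp Require Import ring lra.
From mathcomp.analysis.showcase Require summability.

(** The trapezoidal rule is a finite linear combination of values of [f], so
    it may be applied to the Fourier series term by term: [has_sumZ] and
    [has_sum_sum] say that unconditional sums commute with such combinations.
    On the mode [k] the double sum over the nodes factors into two
    one-dimensional geometric sums, which gives
    [c_k * resonance (k1 / P) * resonance (k2 / P)].  The zero mode contributes
    exactly [c_0], and taking it away ([has_sum_delete]) turns the value of the
    rule into the bias; this is the first series.

    At a multiple of [1 / P] the resonance is a mean of powers of a [P]-th root
    of unity, hence 1 or 0 according to whether [P] divides the frequency
    ([resonance_int]).  The first series is therefore supported on the lattice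
    [P Z x P Z] of aliased modes, and reindexing this lattice by [Z x Z]
    ([has_sum_reindex]) gives the second series. *)

Set Implicit Arguments.
Unset Strict Implicit.
Unset Printing Implicit Defensive.

Import Order.TTheory GRing.Theory Num.Theory.
Local Open Scope classical_set_scope.
Local Open Scope ring_scope.
Local Open Scope complex_scope.

Lemma has_sumZ (R : realType) (I : choiceType) (D : set I) (u : I -> R[i])
    (c s : R[i]) :
  has_sum D u s -> has_sum D (fun i => c * u i) (c * s).
Proof.
move=> us; have FF := @summability.totally_filter I.
rewrite /has_sum; under eq_fun do rewrite -mulr_sumr.
exact: (@cvgZl_tmp _ R[i]^o _ _ _ c _ _ us).
Qed.

Lemma has_sumD (R : realType) (I : choiceType) (D : set I) (u v : I -> R[i])
    (s t : R[i]) :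
  has_sum D u s -> has_sum D v t -> has_sum D (fun i => u i + v i) (s + t).
Proof.
move=> us vt; have FF := @summability.totally_filter I.
rewrite /has_sum; under eq_fun do rewrite big_split.
exact: (@cvgD _ R[i]^o _ _ _ _ _ _ _ us vt).
Qed.

Lemma has_sum_sum (R : realType) (I J : choiceType) (D : set I) (r : seq J)
    (u : J -> I -> R[i]) (s : J -> R[i]) :
  (forall j, has_sum D (u j) (s j)) ->
  has_sum D (fun i => \sum_(j <- r) u j i) (\sum_(j <- r) s j).
Proof.
move=> us; elim: r => [|j r IHr].
  under eq_fun do rewrite big_nil; rewrite big_nil.
  have FF := @summability.totally_filter I.
  rewrite /has_sum; under eq_fun do rewrite big1_eq.
  exact: (@cvg_cst R[i]^o).
under eq_fun do rewrite big_cons.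
by rewrite big_cons; exact: has_sumD.
Qed.

(** Once a finite set contains [k0], its partial sum over the indices other
    than [k0] is the full partial sum minus [u k0]. *)
Lemma has_sum_delete (R : realType) (I : choiceType) (u : I -> R[i])
    (s : R[i]) (k0 : I) :
  has_sum [set: I] u s -> has_sum [set k | k != k0] u (s - u k0).
Proof.
move=> us; have FF := @summability.totally_filter I.
have uk0 := @cvg_cst R[i]^o (u k0) _ (@summability.totally I) FF.
have usk0 := @cvgB _ R[i]^o _ _ FF _ _ _ _ us uk0.
apply: cvg_trans _ usk0; apply: near_eq_cvg.
exists [fset k0]%fset => // A /= k0A.
have {}k0A : k0 \in A by rewrite -fsub1set.
suff : \sum_(i <- A | i \in [set k | k != k0]) u i
    = \sum_(i <- A | i \in [set: I]) u i - u k0 by [].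
have notinE i : (i \in [set k | k != k0]) = (i != k0).
  by apply/idP/idP; rewrite inE.
rewrite (eq_bigl _ _ notinE) [in RHS](big_rem k0) ?in_setT //=.
rewrite rem_filter ?fset_uniq // big_filter_cond.
under [in RHS]eq_bigl do rewrite in_setT andbT.
by rewrite addrC addrK.
Qed.

(** Restricting an unconditional sum to the image of [g], outside of which [u]
    vanishes, and pulling back along [g].  The map [h] serves to carry a finite
    set of indices, beyond which the sums of [u] are close to [s], to a finite
    set that does the same for [u \o g]; it also detects the image of [g] as
    the set of fixed points of [g \o h]. *)
Lemma has_sum_reindex (R : realType) (I J : choiceType) (D : set I) (E : set J)
    (g : J -> I) (h : I -> J) (u : I -> R[i]) (s : R[i]) :
  cancel g h ->
  (forall j, (g j \in D) = (j \in E)) ->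
  (forall i, g (h i) != i -> u i = 0) ->
  has_sum D u s -> has_sum E (u \o g) s.
Proof.
move=> gK gDE u0 us V /us [A0 _ A0V].
exists [fset h i | i in A0]%fset => // A /= hA0.
(* A finite set that contains A0, as the limit of u requires, and that has
   only the g j with j in A as points in the image of g. *)
pose B := (A0 `|` [fset g j | j in A])%fset.
suff -> : \sum_(j <- A | j \in E) (u \o g) j = \sum_(i <- B | i \in D) u i.
  by apply: A0V; exact: fsubsetUl.
rewrite [LHS]big_mkcond [RHS]big_mkcond /=.
rewrite -(@big_fset_incl _ _ _ _ [fset g j | j in A]%fset B) /=; first last.
- move=> i; rewrite inE => /orP[iA0 /negP iA|-> //]; case: ifP => // _.
  apply: u0; apply/eqP => gh; apply: iA; rewrite -gh; apply: in_imfset.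
  by apply: (fsubsetP hA0); apply: in_imfset.
- exact: fsubsetUr.
rewrite big_imfset /=; last by move=> ? ? _ _ /(can_inj gK).
by apply: eq_bigr => j _; rewrite gDE.
Qed.

Lemma e2piD (R : realType) (x y : R) : e2pi (x + y) = e2pi x * e2pi y.
Proof.
rewrite /e2pi /expi mulrDr cosD sinD; apply/eqP; rewrite eq_complex /=.
by rewrite eqxx /= addrC.
Qed.

Lemma e2pi0 (R : realType) : e2pi 0 = 1 :> R[i].
Proof. by rewrite /e2pi /expi mulr0 cos0 sin0. Qed.

Lemma e2piMn (R : realType) (x : R) n : e2pi (x * n%:R) = e2pi x ^+ n.
Proof.
elim: n => [|n IHn]; first by rewrite mulr0 e2pi0.
by rewrite -natr1 mulrDr mulr1 e2piD IHn exprSr.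
Qed.

Lemma e2pi_int (R : realType) (m : int) : e2pi m%:~R = 1 :> R[i].
Proof.
have e1 : e2pi 1 = 1 :> R[i].
  by rewrite /e2pi /expi mulr1 mulr_natl cos2pi sin2pi.
have en n : e2pi n%:R = 1 :> R[i] by rewrite -[n%:R]mul1r e2piMn e1 expr1n.
case: m => n; first exact: en.
have : e2pi ((Negz n)%:~R + n.+1%:R) = 1 :> R[i].
  by rewrite NegzE mulrNz addNr e2pi0.
by rewrite e2piD en mulr1.
Qed.

(** By the double-angle formula the real part is [1 - 2 sin(pi t)^2], and
    [sin] is positive on [(0, pi)]. *)
Lemma e2pi_neq1 (R : realType) (t : R) : 0 < t < 1 -> e2pi t != 1.
Proof.
move=> /andP[t0 t1]; rewrite /e2pi /expi eq_complex /= negb_and.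
apply/orP; left.
have pi0 := pi_gt0 R.
have st : 0 < sin (pi * t).
  by apply: sin_gt0_pi; rewrite mulr_gt0 //= gtr_pMr.
rewrite -mulrA mulr_natl cos_mulr2n cos2sin2 -subr_eq0.
suff : 0 < sin (pi * t) ^+ 2 by move=> ?; lra.
exact: exprn_gt0.
Qed.

(** Orthogonality of characters: the sum of the powers of a [P]-th root of
    unity [w] vanishes unless [w = 1], because [w - 1] times it is
    [w ^+ P - 1 = 0]. *)
Lemma resonance_int (R : realType) (P : nat) (k : int) : (0 < P)%N ->
  resonance P (k%:~R / P%:R : R) = (P%:Z %| k)%Z%:R.
Proof.
move=> P0; have PR : (P%:R : R) != 0 by rewrite pnatr_eq0 -lt0n.
have PC : (P%:R : R[i]) != 0 by rewrite pnatr_eq0 -lt0n.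
rewrite /resonance; under eq_bigr do rewrite e2piMn.
set w := e2pi _.
have w1 : (w == 1) = (P%:Z %| k)%Z.
  have wE : w = e2pi ((k %% P)%Z%:~R / P%:R).
    rewrite /w {1}(divz_eq k P) rmorphD rmorphM /= mulrDl mulfK //.
    by rewrite e2piD e2pi_int mul1r.
  have Pz : 0 < P%:Z by [].
  have := modz_ge0 k (lt0r_neq0 Pz); have := ltz_pmod k Pz.
  have -> : (P%:Z %| k)%Z = ((k %% P)%Z == 0) by apply/dvdz_mod0P/eqP.
  case: (k %% P)%Z wE => [r -> rP _|//]; rewrite eqz_nat.
  have [->|r0] := eqVneq r 0%N; first by rewrite mul0r e2pi0 eqxx.
  apply/negbTE/e2pi_neq1; rewrite divr_gt0 ?ltr0n //= ?lt0n //.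
  by rewrite ltr_pdivrMr ?ltr0n // mul1r ltr_nat.
case: (boolP (P%:Z %| k)%Z) => Pk.
  move: w1; rewrite Pk => /eqP ->; under eq_bigr do rewrite expr1n.
  by rewrite sumr_const card_ord mulVf.
have wn1 : w - 1 != 0 by rewrite subr_eq0 w1.
have : (w - 1) * \sum_(j < P) w ^+ j = 0.
  by rewrite -subrX1 /w -e2piMn divfK // e2pi_int subrr.
by move/eqP; rewrite mulf_eq0 (negPf wn1) => /eqP ->; rewrite mulr0.
Qed.

Theorem mainTheorem5 (R : realType) (f : R * R -> R[i]) (P : nat)
    (f_periodic1 : periodic f (1, 0))
    (f_periodic2 : periodic f (0, 1))
    (coef_summable : abs_summable [set: int * int] (fourier_coef f))
    (f_fourier : forall x : R * R,
      has_sum [set: int * int] (fun k => fourier_coef f k * e2pi (dotp k x))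
        (f x))
    (P_ge2 : (2 <= P)%N) :
  has_sum [set k : int * int | k != (0, 0)]
    (fun k => fourier_coef f k * resonance P (k.1%:~R / P%:R)
                               * resonance P (k.2%:~R / P%:R))
    (bias P f)
  /\
  has_sum [set l : int * int | l != (0, 0)]
    (fun l => fourier_coef f (l.1 * P%:Z, l.2 * P%:Z))
    (bias P f).
Proof.
have P0 : (0 < P)%N by exact: leq_trans P_ge2.
have PC : (P%:R : R[i]) != 0 by rewrite pnatr_eq0 -lt0n.
have Pz : P%:Z != 0 by rewrite eqz_nat -lt0n.
pose w (k : int * int) : R[i] := fourier_coef f k
  * resonance P (k.1%:~R / P%:R) * resonance P (k.2%:~R / P%:R).
have sumw : has_sum [set: int * int] w (trapezoid P f).
  (* The mode k, sampled by the rule, splits into a product of resonances. *)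
  have -> : w = fun k => (P%:R ^+ 2)^-1 *
      \sum_(j1 < P) \sum_(j2 < P) fourier_coef f k *
        e2pi (dotp k (j1%:R / P%:R, j2%:R / P%:R)).
    have nodeE (m : int) j :
        m%:~R * (j%:R / P%:R) = m%:~R / P%:R * j%:R :> R.
      by rewrite mulrA mulrAC.
    apply/funext => k; under [in RHS]eq_bigr => j1 _.
      under eq_bigr => j2 _ do rewrite /dotp /= !nodeE e2piD mulrA.
      rewrite -mulr_sumr; over.
    by rewrite -mulr_suml -mulr_sumr /w /resonance; field.
  by apply: has_sumZ; apply: has_sum_sum => j1; apply: has_sum_sum => j2.
have wE k : w k = fourier_coef f k * (P%:Z %| k.1)%Z%:R * (P%:Z %| k.2)%Z%:R.
  by rewrite /w !resonance_int.
have bias_w : has_sum [set k : int * int | k != (0, 0)] w (bias P f).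
  have -> : bias P f = trapezoid P f - w (0, 0).
    by rewrite wE /= dvdz0 !mulr1.
  exact: has_sum_delete.
split=> //.
(* On the modes (l1 P, l2 P) both resonance factors are 1. *)
have -> : (fun l : int * int => fourier_coef f (l.1 * P%:Z, l.2 * P%:Z))
    = w \o (fun l => (l.1 * P%:Z, l.2 * P%:Z)).
  by apply/funext => l; rewrite /= wE !dvdz_mull // !mulr1.
apply: (@has_sum_reindex _ _ _ _ _ _ (fun k => ((k.1 %/ P)%Z, (k.2 %/ P)%Z)))
  bias_w.
- by case=> l1 l2; rewrite /= !mulzK.
- by case=> l1 l2; apply/idP/idP; rewrite !inE /= !xpair_eqE !mulf_eq0
    (negPf Pz) !orbF.
- case=> k1 k2 /= kP; rewrite wE /=.
  have [k1P|] := boolP (P%:Z %| k1)%Z; last by rewrite mulr0 mul0r.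
  have [k2P|] := boolP (P%:Z %| k2)%Z; last by rewrite mulr0.
  by rewrite !divzK // eqxx in kP.
Qed.
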